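(* Let $k\ge 2$. (i) For any $l\in\mathbb{Q}^k_{>0}$ and any $k$-dimensional lattice $\Lambda\subset\mathbb{Z}^k$, $$\mathrm{gap}(\Lambda,l)\ \ge\ \rho_k\,(\det(\Lambda)\,l_1\cdots l_k)^{1/k}-\sum_{i=1}^k l_i .$$ (ii) For any $c\in\mathbb{Q}^{k+1}_{>0}$ and any $\epsilon>0$ there exists a matrix $A\in\mathbb{Z}^{1\times(k+1)}$ of rank $1$, with $\mathrm{cone}(A)$ pointed and $\{x\in\mathbb{R}^{k+1}:Ax=0\}\cap\mathbb{R}^{k+1}_{\ge 0}=\{0\}$, such that for all $b\in\mathrm{Sg}(A)$ the linear program $LP_c(A,b)$ has a unique optimal solution, with nonbasic variables indexed by $\sigma=\{1,\ldots,k\}$, and, for $l=c'_\sigma$, $$\mathrm{gap}(\Lambda(A),l)\ <\ (\rho_k+\epsilon)\,(\det(\Lambda(A))\,l_1\cdots l_k)^{1/k}-\sum_{i=1}^k l_i .$$ Furthermore, (for this $A$ and $l$) there exists $b'\in\mathrm{Sg}(A)$ such that the optimal value of $IP_c(A,b')$ is equal to $\mathrm{gap}(\Lambda(A),l)+c_{\bar\sigma}A_{\bar\sigma}^{-1}b'$, where $\bar\sigma=\{k+1\}$.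
   Context: Lattice programming gap: for a $k$-dimensional lattice $\Lambda\subset\mathbb{Z}^k$, $l\in\mathbb{Q}^k_{>0}$ and $r\in\mathbb{Z}^k$, let $m(\Lambda,l,r)=\min\{l\cdot x: x\in\mathbb{Z}^k,\ x-r\in\Lambda,\ x\ge 0\}$ (coordinatewise inequality), and $\mathrm{gap}(\Lambda,l)=\max_{r\in\mathbb{Z}^k}m(\Lambda,l,r)$. The constant $\rho_k$: for a closed bounded convex set $K\subset\mathbb{R}^k$ with nonempty interior and a $k$-dimensional lattice $\Lambda\subset\mathbb{R}^k$, the covering radius is $\rho(K,\Lambda)=\min\{r>0: rK+\Lambda=\mathbb{R}^k\}$. Let $X_k$ be the set of all $k$-dimensional lattices in $\mathbb{R}^k$ of determinant one, $\Delta=\{x\in\mathbb{R}^k_{\ge 0}:\sum_{i=1}^k x_i\le 1\}$, and $\rho_k=\inf_{\Lambda\in X_k}\rho(\Delta,\Lambda)$. Integer and linear programs: for $A\in\mathbb{Z}^{1\times(k+1)}$, let $\mathrm{Sg}(A)=\{Au:u\in\mathbb{Z}^{k+1}_{\ge 0}\}$ and $\mathrm{cone}(A)=\{Ax:x\in\mathbb{R}^{k+1}_{\ge 0}\}$. For $c\in\mathbb{Q}^{k+1}$ and $b\in\mathrm{Sg}(A)$, $IP_c(A,b)$ is the program $\min\{c\cdot x: Ax=b,\ x\in\mathbb{Z}^{k+1}_{\ge 0}\}$ and $LP_c(A,b)$ is its linear relaxation $\min\{c\cdot x:Ax=b,\ x\in\mathbb{R}^{k+1},\ x\ge 0\}$.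 For an index set $\tau\subset\{1,\ldots,k+1\}$, $x_\tau$ (resp. $A_\tau$) denotes the entries of $x$ (resp. columns of $A$) indexed by $\tau$, and $\bar\tau$ is the complement of $\tau$. That the optimal solution has nonbasic variables indexed by $\sigma=\{1,\ldots,k\}$ means that it is the basic solution with basic variable index set $\bar\sigma=\{k+1\}$, i.e. $x_\sigma=0$ and $x_{k+1}=A_{\bar\sigma}^{-1}b$. The reduced cost vector is $c'_\sigma=c_\sigma-c_{\bar\sigma}A_{\bar\sigma}^{-1}A_\sigma$. Lattices: $\mathcal{L}(A)=\{x\in\mathbb{Z}^{k+1}:Ax=0\}$ and $\Lambda(A)=\pi(\mathcal{L}(A))\subset\mathbb{Z}^k$, where $\pi:\mathbb{R}^{k+1}\to\mathbb{R}^k$ forgets the last coordinate (the one indexed by $\bar\sigma=\{k+1\}$). *)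

(* Defs.v *)
From HB Require Import structures.
From mathcomp Require Import all_boot all_order all_algebra.
From mathcomp Require Import all_classical all_reals all_analysis.
Set Implicit Arguments.
Unset Strict Implicit.
Unset Printing Implicit Defensive.
Import Order.TTheory GRing.Theory Num.Theory.
Local Open Scope classical_set_scope.
Local Open Scope ring_scope.

(* Attained minimum and maximum of a set; both are 0 when not attained. *)
Definition min_of (T : numDomainType) (S : set T) : T :=
  xget 0 (S `&` lbound S).

Definition max_of (T : numDomainType) (S : set T) : T :=
  xget 0 (S `&` ubound S).

Definition nonneg_vec (T : numDomainType) (n : nat) : set 'cV[T]_n :=
  [set x | forall i, 0 <= x i 0].

Section Lattices.
Variables (R : realType) (k : nat).

Definition lattice_of_basis (B : 'M[R]_k) : set 'cV[R]_k :=
  [set B *m map_mx intr z | z in [set: 'cV[int]_k]].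

Definition is_lattice (L : set 'cV[R]_k) : Prop :=
  exists2 B : 'M[R]_k, B \in unitmx & L = lattice_of_basis B.

(* The set below has exactly one element when L is a lattice, because any two
   bases differ by a unimodular matrix. *)
Definition lattice_det (L : set 'cV[R]_k) : R :=
  xget 0 [set d | exists B : 'M[R]_k,
    [/\ B \in unitmx, L = lattice_of_basis B & d = `|\det B|]].

Definition int_points (Lam : set 'cV[int]_k) : set 'cV[R]_k :=
  [set map_mx intr z | z in Lam].

Definition covering_radius (K L : set 'cV[R]_k) : R :=
  min_of [set r : R | 0 < r /\
    [set r *: x + y | x in K & y in L] = [set: 'cV[R]_k]].

Definition std_simplex : set 'cV[R]_k :=
  [set x | nonneg_vec x /\ \sum_i x i 0 <= 1].

Definition unimodular_lattices : set (set 'cV[R]_k) :=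
  [set L | is_lattice L /\ lattice_det L = 1].

Definition rho : R :=
  inf [set covering_radius std_simplex L | L in unimodular_lattices].

End Lattices.

Arguments int_points R {k} Lam.

Definition gap_min (k : nat) (Lam : set 'cV[int]_k) (l : 'rV[rat]_k)
    (r : 'cV[int]_k) : rat :=
  min_of [set (l *m map_mx intr x) 0 0 |
    x in [set x : 'cV[int]_k | Lam (x - r) /\ nonneg_vec x]].

Definition gap (k : nat) (Lam : set 'cV[int]_k) (l : 'rV[rat]_k) : rat :=
  max_of (range (gap_min Lam l)).

Section Programs.
Variables (R : realType) (m n : nat).

Definition Sg (A : 'M[int]_(m, n)) : set 'cV[int]_m :=
  [set A *m u | u in @nonneg_vec int n].

Definition cone_of (A : 'M[int]_(m, n)) : set 'cV[R]_m :=
  [set map_mx intr A *m x | x in @nonneg_vec R n].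

Definition pointed (C : set 'cV[R]_m) : Prop :=
  C `&` [set - x | x in C] = [set 0].

Definition real_kernel (A : 'M[int]_(m, n)) : set 'cV[R]_n :=
  [set x | map_mx intr A *m x = 0].

Definition IP_value (c : 'rV[rat]_n) (A : 'M[int]_(m, n)) (b : 'cV[int]_m)
    : rat :=
  min_of [set (c *m map_mx intr x) 0 0 |
    x in [set x : 'cV[int]_n | A *m x = b /\ nonneg_vec x]].

Definition LP_feasible (A : 'M[int]_(m, n)) (b : 'cV[int]_m) : set 'cV[R]_n :=
  [set x | map_mx intr A *m x = map_mx intr b /\ nonneg_vec x].

Definition LP_optimal (c : 'rV[rat]_n) (A : 'M[int]_(m, n)) (b : 'cV[int]_m)
    : set 'cV[R]_n :=
  [set x | LP_feasible A b x /\
    forall y, LP_feasible A b y ->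
      (map_mx ratr c *m x) 0 0 <= (map_mx ratr c *m y) 0 0].

End Programs.

Arguments cone_of R {m n} A.
Arguments real_kernel R {m n} A.
Arguments LP_feasible R {m n} A b.
Arguments LP_optimal R {m n} c A b.

(* Coordinates are indexed by 'I_(k + 1): the first k form the nonbasic index
   set sigma and the last one is its complement, so that A_sigma = lsubmx A,
   A_sigmabar = rsubmx A, x_sigma = usubmx x and x_sigmabar = dsubmx x. *)

Definition basic_solution (F : fieldType) (k : nat) (A : 'M[F]_(1, k + 1))
    (b : 'cV[F]_1) (x : 'cV[F]_(k + 1)) : Prop :=
  [/\ rsubmx A \in unitmx, usubmx x = 0
    & dsubmx x = invmx (rsubmx A) *m b].

Definition reduced_cost (F : fieldType) (k : nat) (A : 'M[F]_(1, k + 1))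
    (c : 'rV[F]_(k + 1)) : 'rV[F]_k :=
  lsubmx c - rsubmx c *m invmx (rsubmx A) *m lsubmx A.

Definition int_kernel (m n : nat) (A : 'M[int]_(m, n)) : set 'cV[int]_n :=
  [set x | A *m x = 0].

Definition Lambda (k : nat) (A : 'M[int]_(1, k + 1)) : set 'cV[int]_k :=
  [set usubmx x | x in int_kernel A].

(* Main.v *)
Require Import Defs.
From HB Require Import structures.
From mathcomp Require Import all_boot all_order all_algebra.
From mathcomp Require Import all_classical all_reals all_analysis.
From mathcomp Require Import zify ring lra.
Import Order.TTheory GRing.Theory Num.Theory.
Import numFieldNormedType.Exports.
Local Open Scope classical_set_scope.
Local Open Scope ring_scope.

(* Kannan's identity: gap(Lambda, l) + l_1 + ... + l_k is the covering radius
   of the standard simplex for the scaled lattice diag(l) Lambda, so (i) is the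
   definition of rho_k after normalising determinants.  For (ii), choose a
   unimodular lattice whose covering radius is nearly rho_k and look for a row
   A whose lattice diag(l) Lambda(A) is, up to scaling, close to it, although l
   depends on A.  The kernel of A is spanned by the columns of a (k+1) x k
   integer matrix Q = [P; q], with Lambda(A) = P Z^k and
   A_sigma / A_{k+1} = - q P^-1, so that all requirements on A become open,
   scale-invariant conditions on Q.  They hold for some real matrix, hence for
   an integer matrix W, hence for t W + E when t is large; and E can be chosen
   such that the columns of t W + E generate a saturated lattice for every t. *)

(** * Attained minima and maxima, and exhaustive search over integer boxes *)

Lemma min_ofE (T : numDomainType) (S : set T) (x : T) :
  S x -> lbound S x -> min_of S = x.
Proof.
move=> Sx lx; apply: xget_unique => // y [Sy ly].
by apply/eqP; rewrite eq_le ly // lx.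
Qed.

Lemma max_ofE (T : numDomainType) (S : set T) (x : T) :
  S x -> ubound S x -> max_of S = x.
Proof.
move=> Sx ux; apply: xget_unique => // y [Sy uy].
by apply/eqP; rewrite eq_le ux // uy.
Qed.

(** A sublevel set of [f] inside a box is finite; the box is enumerated by finite functions into
    ['I_(N + N).+1], shifted by [N]. *)
Lemma int_box_argmin d (T : orderType d) (k N : nat) (S : set 'cV[int]_k)
    (f : 'cV[int]_k -> T) (z1 : 'cV[int]_k) :
  S z1 ->
  (forall z, S z -> (f z <= f z1)%O -> forall i, `|z i 0| <= N%:Z) ->
  exists2 z0, S z0 & forall z, S z -> (f z0 <= f z)%O.
Proof.
move=> Sz1 bnd.
pose g (w : {ffun 'I_k -> 'I_(N + N).+1}) : 'cV[int]_k :=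
  \col_i ((w i : nat)%:Z - N%:Z).
have gsurj (z : 'cV[int]_k) : (forall i, `|z i 0| <= N%:Z) -> exists w, g w = z.
  move=> zN; exists [ffun i => inord (absz (z i 0 + N%:Z))].
  apply/matrixP=> i j; rewrite (ord1 j) mxE ffunE.
  have := zN i; rewrite ler_norml => /andP[lo hi].
  have ge0 : 0 <= z i 0 + N%:Z by rewrite -lerBlDr sub0r.
  rewrite inordK; first by rewrite gez0_abs // addrK.
  by rewrite ltnS -lez_nat gez0_abs // PoszD lerD2r.
have [w1 gw1] := gsurj _ (bnd _ Sz1 (lexx _)).
have Pw1 : `[< S (g w1) >] by apply/asboolP; rewrite gw1.
case: (@arg_minP _ _ _ w1 [pred w | `[< S (g w) >]] (fun w => f (g w)) Pw1).
move=> w0 /asboolP Sw0 minw; exists (g w0) => // z Sz.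
case: (leP (f z) (f z1)) => [le1|/ltW lt1].
  have [w gw] := gsurj _ (bnd _ Sz le1).
  by rewrite -gw; apply: minw; apply/asboolP; rewrite gw.
by apply: le_trans lt1; rewrite -gw1; apply: minw; apply/asboolP; rewrite gw1.
Qed.

(** * Lattices generated by integer matrices *)

Definition int_lattice {k : nat} (P : 'M[int]_k) : set 'cV[int]_k :=
  range (mulmx P).

Lemma int_latticeD {k} (P : 'M[int]_k) x y :
  int_lattice P x -> int_lattice P y -> int_lattice P (x + y).
Proof. by move=> [u _ <-] [v _ <-]; exists (u + v) => //; rewrite mulmxDr. Qed.

Lemma int_latticeN {k} (P : 'M[int]_k) x :
  int_lattice P x -> int_lattice P (- x).
Proof. by move=> [u _ <-]; exists (- u) => //; rewrite mulmxN. Qed.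

(** The adjugate gives the preimage. This makes the quotient by the lattice finite and lets any
    representative be moved into the orthant. *)
Lemma int_lattice_det {k} (P : 'M[int]_k) (x : 'cV[int]_k) :
  int_lattice P (`|\det P| *: x).
Proof.
have detx : int_lattice P (\det P *: x).
  by exists (\adj P *m x) => //; rewrite mulmxA mul_mx_adj mul_scalar_mx.
case: (ger0P (\det P)) => // _; rewrite scaleNr; exact: int_latticeN.
Qed.

(** * Attainment of the two optima that define the gap *)

Section Gap.
Context {k : nat} (P : 'M[int]_k) (l : 'rV[rat]_k).
Hypotheses (detP : \det P != 0) (l_gt0 : forall i, 0 < l 0 i).

Let value (x : 'cV[int]_k) : rat := (l *m map_mx intr x) 0 0.

Lemma le_gap_value (x : 'cV[int]_k) i :
  nonneg_vec x -> l 0 i * (x i 0)%:~R <= value x.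
Proof.
move=> x0; rewrite /value mxE (bigD1 i) //= mxE lerDl.
by apply: sumr_ge0 => j _; rewrite mxE mulr_ge0 ?ler0z ?x0 // ltW.
Qed.

Lemma gap_minP (r : 'cV[int]_k) :
  exists x, [/\ int_lattice P (x - r), nonneg_vec x,
    gap_min (int_lattice P) l r = value x
    & forall y, int_lattice P (y - r) -> nonneg_vec y -> value x <= value y].
Proof.
pose S := [set x : 'cV[int]_k | int_lattice P (x - r) /\ nonneg_vec x].
have [x1 Sx1] : exists x, S x.
  (* The shift lies in the lattice, and |det P| >= 1 makes it outweigh every negative coordinate of
     [r]. *)
  exists (r + `|\det P| *: (\col_i `|r i 0|)); split.
    rewrite addrC addKr; exact: int_lattice_det.
  move=> i; rewrite !mxE -lerBlDl sub0r.
  apply: le_trans (_ : 1 * `|r i 0| <= _).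
    by rewrite mul1r lerNl; apply: lerNnormlW.
  by rewrite ler_wpM2r // -gtz0_ge1 normr_gt0.
(* Positivity of [l] bounds coordinate [i] of any point no costlier than [x1] by [value x1 / l 0 i];
   the sum serves all coordinates at once. *)
pose M := \sum_i value x1 / l 0 i.
have vx1 : 0 <= value x1.
  rewrite /value mxE; apply: sumr_ge0 => j _.
  by rewrite mxE mulr_ge0 ?ler0z ?(ltW (l_gt0 _)) //; case: Sx1.
have [x0 [Lx0 px0] minx0] : exists2 z0, S z0 & forall z, S z -> value z0 <= value z.
  apply: (@int_box_argmin _ _ _ `|Num.ceil M|%N _ _ x1) => //.
  move=> z [_ z0] zx1 i; rewrite ger0_norm //.
  have M0 : 0 <= M by apply: sumr_ge0 => j _; rewrite divr_ge0 // ltW.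
  rewrite gez0_abs; last by rewrite -(ler_int rat); apply: le_trans (ceil_ge M).
  rewrite -(ler_int rat); apply: le_trans (ceil_ge M).
  rewrite /M (bigD1 i) //=; apply: le_trans (_ : value x1 / l 0 i <= _).
    by rewrite ler_pdivlMr // mulrC; apply: le_trans zx1; apply: le_gap_value.
  by rewrite lerDl; apply: sumr_ge0 => j _; rewrite divr_ge0 // ltW.
exists x0; split=> //; last by move=> y Ly y0; apply: minx0.
by apply: min_ofE; [exists x0 | move=> _ [y Sy <-]; apply: minx0].
Qed.

Lemma gap_min_congr (r r' : 'cV[int]_k) :
  int_lattice P (r - r') ->
  gap_min (int_lattice P) l r = gap_min (int_lattice P) l r'.
Proof.
move=> Lr; rewrite /gap_min; congr (min_of (image _ _)).
apply/seteqP; split=> x [Lx x0]; split=> //.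
  by rewrite -(subrKA r); apply: int_latticeD.
by rewrite -(subrKA r'); apply: int_latticeD => //; rewrite -opprB; apply: int_latticeN.
Qed.

(** The inner minimum depends only on [r] modulo the lattice, so reducing coordinates modulo |det P|
    leaves finitely many cases. *)
Lemma gapP :
  exists2 r, gap (int_lattice P) l = gap_min (int_lattice P) l r
  & forall r', gap_min (int_lattice P) l r' <= gap (int_lattice P) l.
Proof.
pose D : int := `|\det P|.
have D_gt0 : 0 < D by rewrite normr_gt0.
pose box : set 'cV[int]_k := [set r | forall i, `|r i 0| <= `|\det P|%N%:Z].
have [r0 _ minr0] : exists2 r0, box r0 &
    forall r, box r -> - gap_min (int_lattice P) l r0 <= - gap_min (int_lattice P) l r.
  apply: (@int_box_argmin _ _ _ `|\det P|%N _
            (fun r => - gap_min (int_lattice P) l r) 0); last by move=> z bz _.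
  by move=> i; rewrite mxE normr0.
have maxr r : gap_min (int_lattice P) l r <= gap_min (int_lattice P) l r0.
  pose r' : 'cV[int]_k := \col_i modz (r i 0) D.
  rewrite (@gap_min_congr r r').
    rewrite -lerN2; apply: minr0 => i; rewrite mxE ger0_norm ?modz_ge0 ?gt_eqF //.
    by rewrite abszE; apply/ltW; apply: ltz_pmod.
  suff -> : r - r' = D *: \col_i divz (r i 0) D by apply: int_lattice_det.
  apply/matrixP=> i j; rewrite (ord1 j) !mxE.
  by rewrite {1}(divz_eq (r i 0) D) addrK mulrC.
have gapE : gap (int_lattice P) l = gap_min (int_lattice P) l r0.
  by apply: max_ofE; [exists r0 | move=> _ [r _ <-]].
by exists r0 => // r; rewrite gapE.
Qed.

End Gap.

(** * Coverings by dilated simplices and Kannan's identity *)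

Definition covers {R : realType} {k : nat} (B : 'M[R]_k) (s : R) : Prop :=
  forall y : 'cV[R]_k, exists z : 'cV[int]_k,
    nonneg_vec (y - B *m map_mx intr z) /\
    \sum_i (y - B *m map_mx intr z) i 0 <= s.

Section KannanIdentity.
Context {R : realType} {k : nat} (P : 'M[int]_k) (l : 'rV[rat]_k).
Hypotheses (detP : \det P != 0) (l_gt0 : forall i, 0 < l 0 i).

Let L : 'rV[R]_k := map_mx ratr l.
Let B : 'M[R]_k := diag_mx L *m map_mx intr P.

Let L_gt0 i : 0 < L 0 i.
Proof. by rewrite mxE ltr0q. Qed.

Let BE (z : 'cV[int]_k) i :
  (B *m map_mx intr z) i 0 = L 0 i * ((P *m z) i 0)%:~R.
Proof. by rewrite -mulmxA -map_mxM mul_diag_mx !mxE. Qed.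

Let valueE (x : 'cV[int]_k) :
  ratr ((l *m map_mx intr x) 0 0) = \sum_i L 0 i * (x i 0)%:~R.
Proof.
by rewrite mxE rmorph_sum; apply: eq_bigr => i _; rewrite rmorphM !mxE /= ratr_int.
Qed.

(** Rounding [y_i / L_i] down gives an integer target [r]; the minimiser for [r] costs at most the
    gap, and the fractional parts add at most [L_i] per coordinate. *)
Lemma covers_gap :
  covers B (ratr (gap (int_lattice P) l) + \sum_i L 0 i).
Proof.
move=> y; pose r : 'cV[int]_k := \col_i Num.floor (y i 0 / L 0 i).
have [x [Lx x0 gx _]] := gap_minP P l detP l_gt0 r.
have [_ _ /(_ r)] := gapP P l detP; rewrite gx => gxle.
have [z _ zx] := int_latticeN _ _ Lx; exists z.
have yE i : (y - B *m map_mx intr z) i 0 =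
    L 0 i * (x i 0)%:~R + L 0 i * (y i 0 / L 0 i - (Num.floor (y i 0 / L 0 i))%:~R).
  have Li : L 0 i != 0 by rewrite gt_eqF.
  have zxE : (P *m z) i 0 = Num.floor (y i 0 / L 0 i) - x i 0.
    by rewrite zx opprB mxE [r i 0]mxE [X in _ + X]mxE.
  transitivity (y i 0 - (B *m map_mx intr z) i 0); first by rewrite [LHS]mxE [X in _ + X]mxE.
  by rewrite BE zxE rmorphB /=; field.
split=> [i|].
  rewrite yE addr_ge0 // mulr_ge0 ?ler0z ?x0 ?(ltW (L_gt0 _)) //.
  by rewrite subr_ge0 floor_le.
under eq_bigr do rewrite yE.
rewrite big_split /= lerD //; first by rewrite -valueE ler_rat.
apply: ler_sum => i _; rewrite ler_piMr ?(ltW (L_gt0 _)) //.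
by have := floorD1_gt (y i 0 / L 0 i); rewrite rmorphD /= => /ltW; rewrite lerBlDl addrC.
Qed.

(** Reverse inequality: the bound is first obtained with a loss [d] in every coordinate, and [d] is
    then made small. *)
Lemma gap_le_covers (s : R) :
  covers B s -> ratr (gap (int_lattice P) l) <= s - \sum_i L 0 i.
Proof.
move=> covBs; set T := \sum_i L 0 i.
have T0 : 0 <= T by apply: sumr_ge0 => i _; apply/ltW.
have [r -> _] := gapP P l detP.
have [x [Lx x0 -> minx]] := gap_minP P l detP l_gt0 r.
(* For each integer r, cover the point r + (1 - d): an integer exceeding d - 1
   is nonnegative, so the excess is at least 1 - d in every coordinate. *)
have key (d : R) : 0 < d -> d < 1 ->
    ratr ((l *m map_mx intr x) 0 0) <= s - (1 - d) * T.
  move=> d0 d1.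
  have [z [z0 zs]] := covBs (\col_i (L 0 i * ((r i 0)%:~R + (1 - d)))).
  have yE i : ((\col_i (L 0 i * ((r i 0)%:~R + (1 - d)))) - B *m map_mx intr z) i 0
      = L 0 i * (((r - P *m z) i 0)%:~R + (1 - d)).
    rewrite [LHS]mxE [X in _ + X]mxE BE mxE -mulrBr; congr (_ * _).
    by rewrite [in RHS]mxE [X in (_ + X)%:~R]mxE rmorphB /= addrAC.
  have w0 : nonneg_vec (r - P *m z).
    move=> i; have := z0 i; rewrite yE pmulr_rge0 // -lerBlDr sub0r opprB.
    move=> h; rewrite leNgt; apply/negP; rewrite -lezD1 -(ler_int R) rmorphD /= => n1.
    by lra.
  have wr : int_lattice P ((r - P *m z) - r).
    by rewrite addrAC subrr add0r; apply: int_latticeN; exists z.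
  apply: le_trans (_ : ratr ((l *m map_mx intr (r - P *m z)) 0 0) <= _).
    by rewrite ler_rat; apply: minx.
  rewrite valueE lerBrDr mulr_sumr -big_split /=.
  apply: le_trans zs; apply: ler_sum => i _.
  by rewrite yE mulrDr [(1 - d) * _]mulrC.
rewrite leNgt; apply/negP => lt_s.
set g := ratr _ in key lt_s.
pose e := g - (s - T).
have e0 : 0 < e by rewrite subr_gt0.
have eT : 0 < e + T + 1 by rewrite ltr_wpDl // addr_ge0 // ltW.
(* Taking [d = e / (e + T + 1)] gives [0 < d < 1] and [d T < e], against the assumed excess [e]. *)
have dlt1 : e / (e + T + 1) < 1 by rewrite ltr_pdivrMr // mul1r; lra.
have := key _ (divr_gt0 e0 eT) dlt1.
have : e / (e + T + 1) * T < e.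
  by rewrite mulrAC ltr_pdivrMr // ltr_pM2l //; lra.
by rewrite /e; lra.
Qed.

End KannanIdentity.

(** * Change of basis and determinants of lattices *)

Section BasisChange.
Context {R : realType} {k : nat}.
Implicit Types B : 'M[R]_k.

Lemma lattice_of_basisP B (x : 'cV[R]_k) :
  lattice_of_basis B x <-> exists z, x = B *m map_mx intr z.
Proof. by split=> [[z _ <-]|[z ->]]; exists z. Qed.

Lemma map_delta_mx (j : 'I_k) :
  map_mx intr (delta_mx j 0 : 'cV[int]_k) = delta_mx j 0 :> 'cV[R]_k.
Proof. by apply/matrixP=> a b; rewrite !mxE; case: andb. Qed.

Lemma basis_change B B' :
  lattice_of_basis B' `<=` lattice_of_basis B ->
  exists U : 'M[int]_k, B' = B *m map_mx intr U.
Proof.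
move=> sub.
have /choice[f fP] j : exists z, col j B' = B *m map_mx intr z.
  apply/lattice_of_basisP; apply: sub; apply/lattice_of_basisP.
  by exists (delta_mx j 0); rewrite map_delta_mx colE.
exists (\matrix_(i, j) f j i 0); apply/matrixP=> i j.
have /matrixP/(_ i 0) := fP j; rewrite !mxE => ->.
by apply: eq_bigr => a _; rewrite !mxE.
Qed.

(** A basis of the sublattice is [B U] with [U] integral and nonsingular, and a nonzero integer
    determinant has absolute value at least 1. *)
Lemma le_det_sublattice B B' : B' \in unitmx ->
  lattice_of_basis B' `<=` lattice_of_basis B -> `|\det B| <= `|\det B'|.
Proof.
move=> uB' /basis_change[U E]; move: uB'; rewrite E unitmxE unitfE.
rewrite det_mulmx det_map_mx mulf_eq0 negb_or => /andP[_ U0].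
rewrite normrM ler_peMr // -intr_norm ler1z -gtz0_ge1 normr_gt0.
by apply: contraNneq U0 => ->.
Qed.

Lemma lattice_det_basis B : B \in unitmx ->
  lattice_det (lattice_of_basis B) = `|\det B|.
Proof.
move=> uB; apply: xget_unique; first by exists B.
move=> d [B' [uB' E ->]]; apply/eqP; rewrite eq_le.
by rewrite !le_det_sublattice // E.
Qed.

(** The columns of a real basis are themselves lattice points, hence integral. *)
Lemma int_points_lattice (Lam : set 'cV[int]_k) :
  is_lattice (int_points R Lam) ->
  exists2 P : 'M[int]_k, \det P != 0 & Lam = int_lattice P.
Proof.
move=> [B uB E].
have /choice[f fP] j : exists z : 'cV[int]_k, map_mx intr z = col j B.
  have : lattice_of_basis B (col j B).
    by apply/lattice_of_basisP; exists (delta_mx j 0); rewrite map_delta_mx colE.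
  by rewrite -E => -[z _ <-]; exists z.
pose P := \matrix_(i, j) f j i 0.
have BE : B = map_mx intr P.
  apply/matrixP=> i j; have /matrixP/(_ i 0) := fP j.
  by rewrite !mxE => ->.
have intr_inj : injective (map_mx (intr : int -> R) : 'cV[int]_k -> 'cV[R]_k).
  by move=> u v /matrixP E1; apply/matrixP=> i j; have := E1 i j; rewrite !mxE => /intr_inj.
exists P.
  move: uB; rewrite BE unitmxE unitfE det_map_mx; apply: contraNneq => ->.
  by rewrite rmorph0.
apply/seteqP; split=> [x Lx|_ [z _ <-]].
  have : lattice_of_basis B (map_mx intr x) by rewrite -E; exists x.
  move=> /lattice_of_basisP[z]; rewrite BE -map_mxM => /intr_inj ->.
  by exists z.
have : int_points R Lam (B *m map_mx intr z).
  by rewrite E; apply/lattice_of_basisP; exists z.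
by rewrite BE -map_mxM => -[y Ly /intr_inj <-].
Qed.

Lemma int_points_int_lattice (P : 'M[int]_k) :
  int_points R (int_lattice P) = lattice_of_basis (map_mx intr P).
Proof.
apply/seteqP; split=> [_ [_ [z _ <-] <-]|_ [z _ <-]].
  by exists z; rewrite // map_mxM.
by exists (P *m z); [exists z | rewrite map_mxM].
Qed.

End BasisChange.

(** * The covering radius of the simplex: finiteness, attainment, positivity, scaling *)

Section CoveringRadius.
Context {R : realType} {k : nat}.
Implicit Types B : 'M[R]_k.

Lemma covers_ge0 {B} (s : R) : covers B s -> 0 <= s.
Proof.
move=> /(_ 0)[z [z0 zs]]; apply: le_trans zs.
by apply: sumr_ge0 => i _; apply: z0.
Qed.

(** Rounding leaves a remainder in the unit cube, whose image under [B] has entries between [-c] and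
    [c]; moving [y] by [c] beforehand puts them between 0 and [2c]. *)
Lemma covers_ex B : B \in unitmx -> exists s, covers B s.
Proof.
move=> uB; pose c := \sum_i \sum_j `|B i j|.
exists (\sum_(i < k) (c + c)) => y.
pose w := invmx B *m (y - const_mx c).
pose z : 'cV[int]_k := \col_i Num.floor (w i 0); exists z.
pose f : 'cV[R]_k := w - map_mx intr z.
have yE : y - B *m map_mx intr z = const_mx c + B *m f.
  by rewrite /f mulmxBr /w mulKVmx // addrA addrCA subrr addr0.
have Bf i : `|(B *m f) i 0| <= c.
  rewrite mxE; apply: le_trans (ler_norm_sum _ _ _) _.
  apply: (@le_trans _ _ (\sum_j `|B i j|)).
    apply: ler_sum => j _; rewrite normrM ler_piMr //.
    have -> : f j 0 = w j 0 - (Num.floor (w j 0))%:~R.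
      by rewrite [LHS]mxE [X in _ + X]mxE [(map_mx _ _) _ _]mxE [z j 0]mxE.
    rewrite ger0_norm ?subr_ge0 ?floor_le // lerBlDl; apply: ltW.
    by have := floorD1_gt (w j 0); rewrite rmorphD addrC.
  by rewrite /c [leRHS](bigD1 i) //= lerDl; apply: sumr_ge0 => a _; apply: sumr_ge0.
split=> [i|]; last apply: ler_sum => i _; rewrite yE mxE [X in X + _]mxE;
  have := Bf i; rewrite ler_norml => /andP[lo hi].
  by rewrite addrC -lerBlDr sub0r.
by rewrite lerD2l.
Qed.

(** For fixed [y] the least coordinate sum of a nonnegative remainder is attained and is at most
    every covering [s], hence at most their infimum. *)
Lemma covers_inf B : B \in unitmx -> covers B (inf [set s | covers B s]).
Proof.
move=> uB y; have [s0 cov0] := covers_ex B uB.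
pose S := [set z : 'cV[int]_k | nonneg_vec (y - B *m map_mx intr z)].
pose f (z : 'cV[int]_k) := \sum_i (y - B *m map_mx intr z) i 0.
have [z1 [Sz1 z1s]] := cov0 y.
(* From [z = B^-1 (B z)]: a nonnegative remainder of sum at most [f z1] bounds entry [j] of [B z] by
   |y_j| + [f z1]. *)
pose M := \sum_i \sum_j `|(invmx B) i j| * (`|y j 0| + f z1).
have f0 : 0 <= f z1 by apply: sumr_ge0 => i _; apply: Sz1.
have [z0 Sz0 minz0] : exists2 z0, S z0 & forall z, S z -> f z0 <= f z.
  apply: (@int_box_argmin _ _ _ `|Num.ceil M|%N _ _ z1) => // z Sz zz1 i.
  have M0 : 0 <= M.
    by apply: sumr_ge0 => a _; apply: sumr_ge0 => j _; rewrite mulr_ge0 ?addr_ge0.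
  rewrite gez0_abs; last by rewrite -(ler_int R); apply: le_trans (ceil_ge M).
  rewrite -(ler_int R); apply: le_trans (ceil_ge M).
  have -> : (`|z i 0|)%:~R = `|(invmx B *m (B *m map_mx intr z)) i 0| :> R.
    by rewrite mulKmx // mxE intr_norm.
  rewrite mxE; apply: le_trans (ler_norm_sum _ _ _) _.
  apply: (@le_trans _ _ (\sum_j `|(invmx B) i j| * (`|y j 0| + f z1))).
    apply: ler_sum => j _; rewrite normrM ler_wpM2l //.
    have -> : (B *m map_mx intr z) j 0 = y j 0 - (y - B *m map_mx intr z) j 0.
      by rewrite [X in _ - X]mxE [X in _ - (_ + X)]mxE opprB addrC subrK.
    apply: le_trans (ler_normB _ _) _; rewrite lerD2l ger0_norm; last exact: Sz.
    apply: le_trans zz1; rewrite /f (bigD1 j) //= lerDl.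
    by apply: sumr_ge0 => a _; apply: Sz.
  rewrite /M [leRHS](bigD1 i) //= lerDl; apply: sumr_ge0 => a _; apply: sumr_ge0 => j _.
  by rewrite mulr_ge0 ?addr_ge0.
exists z0; split=> //; apply: lb_le_inf; first by exists s0.
by move=> s /(_ y)[z [Sz zs]]; apply: le_trans zs; apply: minz0.
Qed.

Lemma covers_gt0 B s : (0 < k)%N -> B \in unitmx -> covers B s -> 0 < s.
Proof.
move=> k0 uB cov; rewrite ltNge; apply/negP => s0.
(* With [s <= 0] the remainder vanishes, so a point with half-integral coordinates in the basis [B]
   would be a lattice point. *)
have [z [z0 zs]] := cov (B *m const_mx (2^-1)).
have : \sum_i (B *m const_mx 2^-1 - B *m map_mx intr z) i 0 = 0.
  apply/eqP; rewrite eq_le (le_trans zs s0) /=; apply: sumr_ge0 => i _; exact: z0.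
move=> /eqP; rewrite psumr_eq0 => [/allP sum0|i _]; last exact: z0.
have : B *m const_mx 2^-1 - B *m map_mx intr z = 0.
  apply/matrixP=> i j; rewrite (ord1 j) [RHS]mxE; apply/eqP.
  by apply: (implyP (sum0 i _)) => //; rewrite mem_index_enum.
rewrite -mulmxBr => /(congr1 (mulmx (invmx B))); rewrite mulKmx // mulmx0.
move=> /matrixP/(_ (Ordinal k0) 0); rewrite !mxE => /eqP; rewrite subr_eq0 => /eqP E.
have : (1 : R) = (2 * z (Ordinal k0) 0)%:~R.
  by rewrite rmorphM /= -E mulfV // pnatr_eq0.
rewrite -[1]/(1%:~R) => /intr_inj; lia.
Qed.

Lemma covers_simplexP B s : 0 < s ->
  covers B s <->
  [set s *: x + y | x in @std_simplex R k & y in lattice_of_basis B] = setT.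
Proof.
move=> s0; have sN0 : s != 0 by rewrite gt_eqF.
split=> [cov|E y].
  apply/seteqP; split=> // y _; have [z [z0 zs]] := cov y.
  exists (s^-1 *: (y - B *m map_mx intr z)).
    split=> [i|]; first by rewrite mxE mulr_ge0 ?z0 // invr_ge0 ltW.
    under eq_bigr do rewrite mxE.
    by rewrite -mulr_sumr mulrC ler_pdivrMr // mul1r.
  exists (B *m map_mx intr z); first by exists z.
  by rewrite scalerA divff // scale1r subrK.
have : [set: 'cV[R]_k] y by []; rewrite -E => -[x [x0 xs] [_ [z _ <-] <-]].
exists z; rewrite addrK; split=> [i|]; first by rewrite mxE mulr_ge0 // ltW.
under eq_bigr do rewrite mxE.
by rewrite -mulr_sumr -[leRHS]mulr1 ler_pM2l.
Qed.

(** [min_of] would default to 0 if no positive minimum were attained; [covers_inf] and [covers_gt0]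
    exclude this. *)
Lemma covering_radiusE B : (0 < k)%N -> B \in unitmx ->
  covering_radius (@std_simplex R k) (lattice_of_basis B) =
    inf [set s | covers B s].
Proof.
move=> k0 uB; have covi := covers_inf B uB.
have i0 := covers_gt0 _ _ k0 uB covi.
apply: min_ofE; first by split=> //; apply/covers_simplexP.
move=> s [s0 /covers_simplexP cov]; apply: ge_inf; last exact: cov.
by exists 0 => t; apply: covers_ge0.
Qed.

Lemma covers_scale B (t s : R) : 0 < t -> covers B s -> covers (t *: B) (t * s).
Proof.
move=> t0 cov y; have tN0 : t != 0 by rewrite gt_eqF.
have [z [z0 zs]] := cov (t^-1 *: y).
have yE : y - t *: B *m map_mx intr z = t *: (t^-1 *: y - B *m map_mx intr z).
  by rewrite scalerBr scalerA divff // scale1r scalemxAl.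
exists z; rewrite yE; split=> [i|]; first by rewrite mxE mulr_ge0 // ltW.
by under eq_bigr do rewrite mxE; rewrite -mulr_sumr ler_pM2l.
Qed.

End CoveringRadius.

(** * The constant [rho R k] and normalisation of determinants *)

Lemma powR_invnK {R : realType} {k : nat} (x : R) :
  (0 < k)%N -> 0 <= x -> (x `^ k%:R^-1) ^+ k = x.
Proof.
move=> k0 x0; rewrite -powR_mulrn ?powR_ge0 // -powRrM mulVf ?powRr1 //.
by rewrite pnatr_eq0 -lt0n.
Qed.

Section Rho.
Context {R : realType} {k : nat}.
Hypothesis k_gt0 : (0 < k)%N.
Implicit Types B : 'M[R]_k.

Let radii : set R :=
  [set covering_radius (@std_simplex R k) L | L in @unimodular_lattices R k].

Let radii_inf : has_inf radii.
Proof.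
split.
  exists (covering_radius (@std_simplex R k) (lattice_of_basis 1%:M)).
  exists (lattice_of_basis 1%:M) => //; split; first by exists 1%:M; rewrite ?unitmx1.
  by rewrite lattice_det_basis ?unitmx1 // det1 normr1.
exists 0 => _ [_ [[B uB ->] _] <-].
rewrite covering_radiusE //; apply/ltW/(covers_gt0 _ _ k_gt0 uB).
exact: covers_inf.
Qed.

Lemma rho_ge0 : 0 <= rho R k.
Proof.
apply: lb_le_inf; first by case: radii_inf.
move=> _ [_ [[B uB ->] _] <-].
rewrite covering_radiusE //; apply/ltW/(covers_gt0 _ _ k_gt0 uB).
exact: covers_inf.
Qed.

(** Dividing [B] by the k-th root [d] of |det B| gives a unimodular lattice covered with radius
    [s / d]. *)
Lemma rho_le_covers B s : B \in unitmx -> covers B s ->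
  rho R k * `|\det B| `^ k%:R^-1 <= s.
Proof.
move=> uB cov; set d := _ `^ _.
have detB : 0 < `|\det B| by rewrite normr_gt0 -unitfE -unitmxE.
have d0 : 0 < d by apply: powR_gt0.
have dk : d ^+ k = `|\det B| by apply: powR_invnK.
have uB' : d^-1 *: B \in unitmx by rewrite unitmxZ // unitfE invr_eq0 gt_eqF.
rewrite -ler_pdivlMr // mulrC.
have dV : 0 < d^-1 by rewrite invr_gt0.
apply: le_trans (_ : covering_radius (@std_simplex R k) (lattice_of_basis (d^-1 *: B)) <= _).
  apply: ge_inf; first by case: radii_inf.
  exists (lattice_of_basis (d^-1 *: B)) => //; split; first by exists (d^-1 *: B).
  rewrite lattice_det_basis // detZ normrM normrX ger0_norm ?(ltW dV) //.
  by rewrite exprVn dk mulVf // gt_eqF.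
rewrite covering_radiusE //; apply: ge_inf; last exact: covers_scale.
by exists 0 => t; apply: covers_ge0.
Qed.

Lemma rho_approx (e : R) : 0 < e ->
  exists B s, [/\ `|\det B| = 1, covers B s & s < rho R k + e].
Proof.
move=> e0; have [_ [_ [[B uB ->] detB] <-] lt_e] := inf_adherent e0 radii_inf.
exists B, (inf [set s | covers B s]); split; last by rewrite -covering_radiusE.
  by rewrite -lattice_det_basis.
exact: covers_inf.
Qed.

End Rho.

(** * Entrywise limits of matrix sequences *)

Section EntrywiseConvergence.
Context {R : realType}.

Definition mx_cvg {m n} (F : nat -> 'M[R]_(m, n)) (M : 'M[R]_(m, n)) : Prop :=
  forall i j, F t i j @[t --> \oo] --> M i j.

Lemma cvg_bigsum (I : Type) (r : seq I) (p : pred I) (u : I -> nat -> R) (v : I -> R) :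
  (forall i, u i t @[t --> \oo] --> v i) ->
  (\sum_(i <- r | p i) u i t) @[t --> \oo] --> \sum_(i <- r | p i) v i.
Proof. by move=> uv; apply: cvg_big => //; apply: add_continuous. Qed.

Lemma cvg_bigprod (I : Type) (r : seq I) (p : pred I) (u : I -> nat -> R) (v : I -> R) :
  (forall i, u i t @[t --> \oo] --> v i) ->
  (\prod_(i <- r | p i) u i t) @[t --> \oo] --> \prod_(i <- r | p i) v i.
Proof. by move=> uv; apply: cvg_big => //; apply: mul_continuous. Qed.

Lemma cvg_expr (u : nat -> R) (v : R) k :
  u t @[t --> \oo] --> v -> (u t ^+ k) @[t --> \oo] --> v ^+ k.
Proof.
move=> uv; elim: k => [|k IHk]; first exact: cvg_cst.
by under eq_fun do rewrite exprS; rewrite exprS; apply: cvgM.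
Qed.

Lemma mx_cvg_cst m n (M : 'M[R]_(m, n)) : mx_cvg (fun=> M) M.
Proof. by move=> i j; apply: cvg_cst. Qed.

Lemma mx_cvgD m n F G (M N : 'M[R]_(m, n)) :
  mx_cvg F M -> mx_cvg G N -> mx_cvg (fun t => F t + G t) (M + N).
Proof.
by move=> FM GN i j; under eq_fun do rewrite mxE; rewrite mxE; apply: cvgD.
Qed.

Lemma mx_cvgN m n F (M : 'M[R]_(m, n)) :
  mx_cvg F M -> mx_cvg (fun t => - F t) (- M).
Proof.
by move=> FM i j; under eq_fun do rewrite mxE; rewrite mxE; apply: cvgN.
Qed.

Lemma mx_cvgZ m n u (v : R) F (M : 'M[R]_(m, n)) :
  u t @[t --> \oo] --> v -> mx_cvg F M ->
  mx_cvg (fun t => u t *: F t) (v *: M).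
Proof.
by move=> uv FM i j; under eq_fun do rewrite mxE; rewrite mxE; apply: cvgM.
Qed.

Lemma mx_cvgM m n p F G (M : 'M[R]_(m, n)) (N : 'M[R]_(n, p)) :
  mx_cvg F M -> mx_cvg G N -> mx_cvg (fun t => F t *m G t) (M *m N).
Proof.
move=> FM GN i j; under eq_fun do rewrite mxE; rewrite mxE.
by apply: cvg_bigsum => a; apply: cvgM.
Qed.

Lemma mx_cvg_det n F (M : 'M[R]_n) :
  mx_cvg F M -> \det (F t) @[t --> \oo] --> \det M.
Proof.
move=> FM; apply: cvg_bigsum => s; apply: cvgM; first exact: cvg_cst.
by apply: cvg_bigprod => i; apply: FM.
Qed.

Lemma mx_cvg_unit n F (M : 'M[R]_n) :
  mx_cvg F M -> M \in unitmx -> \forall t \near \oo, F t \in unitmx.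
Proof.
move=> FM; rewrite unitmxE unitfE => detM.
under eq_near do rewrite unitmxE unitfE.
exact: cvgr_neq0 (mx_cvg_det _ _ _ FM) detM.
Qed.

Lemma mx_cvgV n F (M : 'M[R]_n) : M \in unitmx ->
  mx_cvg F M -> mx_cvg (fun t => invmx (F t)) (invmx M).
Proof.
move=> uM FM.
(* [invmx] is the adjugate over the determinant only on invertible matrices; invertibility of the
   limit makes all late terms invertible. *)
have adj_cvg : mx_cvg (fun t => (\det (F t))^-1 *: \adj (F t)) (invmx M).
  rewrite /invmx uM; apply: mx_cvgZ.
    by apply: cvgV (mx_cvg_det _ _ _ FM); rewrite -unitfE -unitmxE.
  move=> i j; under eq_fun do rewrite mxE; rewrite mxE.
  apply: cvgM; first exact: cvg_cst.
  apply: mx_cvg_det => a b; under eq_fun do rewrite !mxE.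
  by rewrite !mxE; apply: FM.
move=> i j; apply: cvg_trans (adj_cvg i j); apply: near_eq_cvg.
by near=> t; rewrite /invmx ifT //; near: t; apply: mx_cvg_unit uM.
Unshelve. all: by end_near.
Qed.

End EntrywiseConvergence.

(** * Openness and scale invariance of having a small covering radius *)

Section EfficientBases.
Context {R : realType} {k : nat}.
Implicit Types (B F : 'M[R]_k) (kappa : R).

(** Write [F B^-1 = 1 + D]. A remainder [x] of sum at most [s] becomes [x + D x], with error at most
    [e s] per entry; adding the constant [e s] restores nonnegativity, at a total cost of at most
    [2 e s] per coordinate. *)
Lemma covers_perturb B F s : B \in unitmx -> F \in unitmx -> covers B s ->
  let e := \sum_i \sum_j `|((F - B) *m invmx B) i j| in
  covers F (s + \sum_(i < k) (e * s + e * s)).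
Proof.
move=> uB uF cov e y; have s0 := covers_ge0 _ cov.
pose D := (F - B) *m invmx B.
have FBE : F *m invmx B = 1%:M + D by rewrite /D mulmxBl mulmxV // addrC subrK.
pose c : 'cV[R]_k := const_mx (e * s).
have [z [z0 zs]] := cov (B *m invmx F *m (y - c)); exists z.
set x := _ - B *m _ in z0 zs.
have yE : y - F *m map_mx intr z = x + (c + D *m x).
  have : F *m invmx B *m x = y - c - F *m map_mx intr z.
    by rewrite /x mulmxBr !mulmxA !mulmxKV // mulmxV // mul1mx.
  rewrite FBE mulmxDl mul1mx => E.
  by rewrite addrCA E addrA [c + _]addrC subrK.
have xle j : x j 0 <= s.
  apply: le_trans zs; rewrite (bigD1 j) //= lerDl.
  by apply: sumr_ge0 => a _; apply: z0.
have Dx i : `|(D *m x) i 0| <= e * s.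
  rewrite mxE; apply: le_trans (ler_norm_sum _ _ _) _.
  apply: (@le_trans _ _ (\sum_j `|D i j| * s)).
    by apply: ler_sum => j _; rewrite normrM ler_wpM2l // ger0_norm // z0.
  rewrite -mulr_suml ler_wpM2r // /e [leRHS](bigD1 i) //= lerDl.
  by apply: sumr_ge0 => a _; apply: sumr_ge0.
have yEi i : (y - F *m map_mx intr z) i 0 = x i 0 + (e * s + (D *m x) i 0).
  by rewrite yE mxE [X in _ + X]mxE [c _ _]mxE.
split=> [i|].
  rewrite yEi addr_ge0 ?z0 //; have := Dx i.
  by rewrite ler_norml -lerBlDl sub0r => /andP[].
under eq_bigr do rewrite yEi.
rewrite big_split /= lerD // ler_sum // => i _; rewrite lerD2l.
by have := Dx i; rewrite ler_norml => /andP[].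
Qed.

(** The bound [s < kappa |det B|^(1/k)] raised to the power [k]: root-free, homogeneous under
    scaling of [B] and [s], and continuous in both. *)
Definition efficient kappa B : Prop :=
  exists s, [/\ 0 < s, covers B s & s ^+ k < kappa ^+ k * `|\det B|].

Lemma efficient_unit kappa B : 0 <= kappa -> efficient kappa B -> B \in unitmx.
Proof.
move=> kap0 [s [s0 _ /(lt_trans (exprn_gt0 k s0))]].
rewrite unitmxE unitfE -normr_gt0 ltNge => h; rewrite ltNge.
by apply: contra h => h; rewrite mulr_ge0_le0 // exprn_ge0.
Qed.

Lemma efficientZ kappa t B : 0 < t -> efficient kappa B -> efficient kappa (t *: B).
Proof.
move=> t0 [s [s0 cov ltB]]; exists (t * s); split; first exact: mulr_gt0.
  exact: covers_scale.
rewrite exprMn detZ normrM normrX (gtr0_norm t0) mulrCA.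
by rewrite ltr_pM2l // exprn_gt0.
Qed.

(** [covers_perturb] covers with [F t] at radii [st t] tending to [s], and a strict inequality at
    the limit holds for all late terms. *)
Lemma efficient_near kappa (F : nat -> 'M[R]_k) B : 0 <= kappa ->
  mx_cvg F B -> efficient kappa B -> \forall t \near \oo, efficient kappa (F t).
Proof.
move=> kap0 FB effB; have uB := efficient_unit _ _ kap0 effB.
have [s [s0 cov ltB]] := effB.
pose e t := \sum_i \sum_j `|((F t - B) *m invmx B) i j|.
have e_cvg : e t @[t --> \oo] --> (0 : R).
  have -> : 0 = \sum_i \sum_j `|((B - B) *m invmx B) i j| :> R.
    rewrite subrr mul0mx big1 // => i _; rewrite big1 // => j _.
    by rewrite mxE normr0.
  apply: cvg_bigsum => i; apply: cvg_bigsum => j; apply: cvg_norm.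
  apply: (mx_cvgM _ _ _ (fun t => F t - B) (fun=> invmx B)).
    exact: mx_cvgD FB (mx_cvg_cst _ _ _).
  exact: mx_cvg_cst.
pose st t := s + \sum_(i < k) (e t * s + e t * s).
have st_cvg : st t @[t --> \oo] --> s.
  rewrite -[X in _ --> X]addr0; apply: cvgD; first exact: cvg_cst.
  rewrite [X in _ --> X](_ : _ = \sum_(i < k) (0 * s + 0 * s)); last first.
    by rewrite big1 // => i _; lra.
  apply: (cvg_bigsum _ _ _ (fun _ t => e t * s + e t * s)) => i.
  by apply: cvgD; apply: cvgM => //; apply: cvg_cst.
have diff_cvg : (st t ^+ k - kappa ^+ k * `|\det (F t)|) @[t --> \oo] -->
    (s ^+ k - kappa ^+ k * `|\det B|).
  apply: cvgB; first exact: cvg_expr.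
  apply: cvgM; first exact: cvg_cst.
  by apply: cvg_norm; apply: mx_cvg_det.
near=> t; exists (st t); split.
- by near: t; apply: (cvgr_gt s).
- apply: covers_perturb => //; near: t; exact: mx_cvg_unit uB.
- rewrite -subr_lt0; near: t; apply: (cvgr_lt _ diff_cvg).
  by rewrite subr_lt0.
Unshelve. all: by end_near.
Qed.

End EfficientBases.

(* In Smith normal form, adding the matrix with ones just below the diagonal
   makes the lower square block upper unitriangular, whatever the multiplier
   of the diagonal part is. *)
Lemma primitive_perturbation {m k} (W : 'M[int]_(m, k)) : m = k.+1 ->
  exists E : 'M[int]_(m, k), forall t : int, exists a : 'rV[int]_m,
    [/\ a != 0, a *m (t *: W + E) = 0
      & forall x : 'cV[int]_m, a *m x = 0 -> exists z, x = (t *: W + E) *m z].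
Proof.
move=> mk; subst m; move: W; change k.+1 with (1 + k)%N => W.
have [L uL [C uC [d _ WE]]] := int_Smith_normal_form W.
set S := \matrix_(i, j) _ in WE.
exists (L *m col_mx 0 1%:M *m C) => t.
pose g : 'rV[int]_k := t *: usubmx S.
pose G : 'M[int]_k := 1%:M + t *: dsubmx S.
have QE : t *: W + L *m col_mx 0 1%:M *m C = L *m col_mx g G *m C.
  rewrite WE -{1}(vsubmxK S) scalemxAl scalemxAr -mulmxDl -mulmxDr.
  by rewrite scale_col_mx add_col_mx addr0 [_ + 1%:M]addrC.
have uG : G \in unitmx.
  suff detG : \det G = 1 by rewrite unitmxE detG unitr1.
  (* [S] is zero off its main diagonal, so dropping its first row moves the entries just above the
     diagonal of [G]. *)
  rewrite -det_tr det_trig.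
    rewrite big1 // => i _; rewrite !mxE eqxx /= add1n.
    by rewrite gtn_eqF // mulr0n mulr0 addr0.
  apply/is_trig_mxP => i j ij; rewrite !mxE /= add1n.
  have -> : (j == i) = false by apply/negbTE; rewrite -val_eqE /= gtn_eqF.
  by rewrite gtn_eqF ?mulr0n ?mulr0 ?addr0 // ltnS ltnW.
(* This row kills [col_mx g G], and its leading entry 1 keeps it nonzero; a vector in its kernel is
   determined by its lower block. *)
pose a' : 'rV[int]_(1 + k) := row_mx 1%:M (- (g *m invmx G)).
exists (a' *m invmx L); rewrite QE; split.
- apply/eqP => /(congr1 (fun a => lsubmx (a *m L) 0 0)).
  by rewrite mulmxKV // row_mxKl mul0mx !mxE.
- rewrite !mulmxA mulmxKV // mul_row_col mul1mx mulNmx mulmxKV // subrr.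
  by rewrite mul0mx.
- move=> x; rewrite -mulmxA; set y := invmx L *m x => ay.
  exists (invmx C *m (invmx G *m dsubmx y)).
  rewrite !mulmxA mulmxK // -!mulmxA mul_col_mx mulKVmx //.
  have -> : g *m (invmx G *m dsubmx y) = usubmx y.
    move: ay; rewrite -{1}(vsubmxK y) mul_row_col mul1mx mulNmx => /eqP.
    by rewrite subr_eq0 => /eqP ->; rewrite mulmxA.
  by rewrite vsubmxK /y mulKVmx.
Qed.

(** * Kernel bases meeting the requirements of (ii), first real and then integral *)

Section AdmissibleBases.
Context {R : realType} {k : nat}.
Implicit Types (X : 'M[R]_(k + 1, k)) (c : 'rV[R]_(k + 1)).

(* If the columns of [X] span the orthogonal complement of a row [a], then
   [slope X] is [a_sigma] divided by the last entry of [a]. *)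
Definition slope X : 'rV[R]_k := - (dsubmx X *m invmx (usubmx X)).

(** With [slope X] standing for a_sigma / a_{k+1}, this is the reduced cost vector of the row
    [a]. *)
Definition slope_cost c X : 'rV[R]_k := lsubmx c - rsubmx c *m slope X.

(** The requirements of (ii) on a row, read off a basis of its kernel: positive slope gives the
    entries a common sign, positive cost makes the basic solution the unique optimum, and efficiency
    bounds the gap. *)
Definition admissible (kappa : R) c X : Prop :=
  [/\ usubmx X \in unitmx, forall i, 0 < slope X 0 i,
      forall i, 0 < slope_cost c X 0 i
    & efficient kappa (diag_mx (slope_cost c X) *m usubmx X)].

Lemma slopeZ t X : t != 0 -> usubmx X \in unitmx -> slope (t *: X) = slope X.
Proof.
move=> t0 uX; rewrite /slope !linearZ /= invmxZ ?unitmxZ ?unitfE //.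
by rewrite -scalemxAl -scalemxAr scalerA divff // scale1r.
Qed.

Lemma admissibleZ kappa c t X :
  0 < t -> admissible kappa c X -> admissible kappa c (t *: X).
Proof.
move=> t0 [uX sX cX eX]; have sE : slope (t *: X) = slope X.
  by rewrite slopeZ ?gt_eqF.
have uE : usubmx (t *: X) = t *: usubmx X by rewrite linearZ.
split; rewrite /slope_cost ?sE ?uE //; first by rewrite unitmxZ // unitfE gt_eqF.
by rewrite -scalemxAr; apply: efficientZ.
Qed.

Lemma near_row_gt0 (u : nat -> 'rV[R]_k) (v : 'rV[R]_k) :
  mx_cvg u v -> (forall i, 0 < v 0 i) -> \forall t \near \oo, forall i, 0 < u t 0 i.
Proof.
move=> uv v0; apply: filter_forall => i.
exact: (cvgr_gt _ (uv 0 i)).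
Qed.

Lemma admissible_near kappa c (F : nat -> 'M[R]_(k + 1, k)) X : 0 <= kappa ->
  mx_cvg F X -> admissible kappa c X ->
  \forall t \near \oo, admissible kappa c (F t).
Proof.
move=> kap0 FX [uX sX cX eX].
have usub_cvg : mx_cvg (fun t => usubmx (F t)) (usubmx X).
  by move=> i j; under eq_fun do rewrite mxE; rewrite mxE; apply: FX.
have slope_cvg : mx_cvg (fun t => slope (F t)) (slope X).
  apply: mx_cvgN; apply: mx_cvgM; last exact: mx_cvgV.
  by move=> i j; under eq_fun do rewrite mxE; rewrite mxE; apply: FX.
have cost_cvg : mx_cvg (fun t => slope_cost c (F t)) (slope_cost c X).
  apply: mx_cvgD; first exact: mx_cvg_cst.
  by apply: mx_cvgN; apply: mx_cvgM => //; apply: mx_cvg_cst.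
have diag_cvg : mx_cvg (fun t => diag_mx (slope_cost c (F t)) *m usubmx (F t))
    (diag_mx (slope_cost c X) *m usubmx X).
  apply: mx_cvgM => // i j; under eq_fun do rewrite mxE; rewrite mxE.
  by case: (i == j); [apply: cost_cvg | apply: cvg_cst].
near=> t; split; near: t.
- exact: mx_cvg_unit usub_cvg uX.
- exact: near_row_gt0 slope_cvg sX.
- exact: near_row_gt0 cost_cvg cX.
- exact: efficient_near diag_cvg eX.
Unshelve. all: by end_near.
Qed.

Lemma invn_cvg : (t.+1%:R^-1 : R) @[t --> \oo] --> (0 : R).
Proof. exact: cvg_harmonic. Qed.

Lemma floor_cvg (x : R) :
  (t.+1%:R^-1 * (Num.floor (t.+1%:R * x))%:~R) @[t --> \oo] --> x.
Proof.
apply/cvgrPdist_le => e e0; near=> t.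
have t0 : (0 : R) < t.+1%:R by rewrite ltr0n.
have tN0 : t.+1%:R != 0 :> R by rewrite gt_eqF.
apply: (@le_trans _ _ t.+1%:R^-1).
  rewrite -{1}[x](mulKf tN0) -mulrBr normrM.
  rewrite ger0_norm ?invr_ge0 ?(ltW t0) // ler_piMr ?invr_ge0 ?(ltW t0) //.
  have := floorD1_gt (t.+1%:R * x); have := floor_le (t.+1%:R * x).
  rewrite rmorphD /= => lo hi; rewrite ger0_norm; lra.
apply: ltW; near: t; exact: (cvgr_lt _ invn_cvg).
Unshelve. all: by end_near.
Qed.

(** Flooring the entries of [(t + 1) X] and dividing by [t + 1] approaches [X]; openness applies,
    and scale invariance removes the denominator. *)
Lemma admissible_int kappa c X : 0 <= kappa -> admissible kappa c X ->
  exists W : 'M[int]_(k + 1, k), admissible kappa c (map_mx intr W).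
Proof.
move=> kap0 aX.
pose W (t : nat) : 'M[int]_(k + 1, k) := \matrix_(i, j) Num.floor (t.+1%:R * X i j).
have Wcvg : mx_cvg (fun t => t.+1%:R^-1 *: map_mx intr (W t)) X.
  by move=> i j; under eq_fun do rewrite !mxE; apply: floor_cvg.
have [t adm_t] := filter_ex (admissible_near _ _ _ _ kap0 Wcvg aX).
exists (W t); have := admissibleZ _ _ t.+1%:R _ (ltr0Sn _ _) adm_t.
by rewrite scalerA divff ?scale1r // pnatr_eq0.
Qed.

(** After division by [t + 1] the perturbation [E] fades, so admissibility of [W] passes to
    [(t + 1) W + E] for large [t], while saturation holds for every [t]. *)
Lemma admissible_primitive kappa c X : 0 <= kappa -> admissible kappa c X ->
  exists (Q : 'M[int]_(k + 1, k)) (a : 'rV[int]_(k + 1)),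
    [/\ admissible kappa c (map_mx intr Q), a != 0, a *m Q = 0
      & forall x : 'cV[int]_(k + 1), a *m x = 0 -> exists z, x = Q *m z].
Proof.
move=> kap0 /(admissible_int _ _ _ kap0)[W aW].
have [E primE] := primitive_perturbation W (addn1 k).
pose Q (t : nat) : 'M[int]_(k + 1, k) := (t.+1)%:Z *: W + E.
have Qcvg : mx_cvg (fun t => t.+1%:R^-1 *: map_mx intr (Q t)) (map_mx (intr : int -> R) W).
  move=> i j.
  have QE t : (t.+1%:R^-1 *: map_mx intr (Q t)) i j =
      (W i j)%:~R + t.+1%:R^-1 * (E i j)%:~R :> R.
    by rewrite !mxE rmorphD rmorphM /= mulrDr mulrA -pmulrn mulVf ?mul1r.
  under eq_fun do rewrite QE.
  have -> : (map_mx intr W : 'M[R]_(k + 1, k)) i j = (W i j)%:~R + 0 * (E i j)%:~R.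
    by rewrite mxE mul0r addr0.
  apply: cvgD; first exact: cvg_cst.
  by apply: cvgM; [exact: invn_cvg | exact: cvg_cst].
have [t adm_t] := filter_ex (admissible_near _ _ _ _ kap0 Qcvg aW).
have [a [a0 aQ kera]] := primE (t.+1)%:Z; exists (Q t), a; split=> //.
have := admissibleZ _ _ t.+1%:R _ (ltr0Sn _ _) adm_t.
by rewrite scalerA divff ?scale1r // pnatr_eq0.
Qed.

Lemma admissible_ex kappa c : (0 < k)%N -> (forall i, 0 < c 0 i) ->
  rho R k < kappa -> exists X, admissible kappa c X.
Proof.
move=> k0 c0 kap; have kap_rho : 0 < kappa - rho R k by rewrite subr_gt0.
have [B [s [detB cov sk]]] := rho_approx k0 _ kap_rho.
have uB : B \in unitmx by rewrite unitmxE unitfE -normr_gt0 detB.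
have s0 := covers_gt0 _ _ k0 uB cov.
pose cl : R := rsubmx c 0 0.
have cl0 : 0 < cl by rewrite /cl mxE.
(* Half of c_sigma is chosen as reduced cost, which forces the slope [alpha = l / cl]; both are
   positive because [c] is. *)
pose l : 'rV[R]_k := 2^-1 *: lsubmx c.
have l0 i : 0 < l 0 i by rewrite !mxE mulr_gt0 ?invr_gt0 ?ltr0n.
pose alpha : 'rV[R]_k := cl^-1 *: l.
have detl : \det (diag_mx l) != 0.
  by rewrite det_diag gt_eqF // prodr_gt0 // => i _; apply: l0.
have ul : diag_mx l \in unitmx by rewrite unitmxE unitfE.
(* Undoing the scaling by [l] makes the scaled lattice exactly that of [B], and the last row
   [- alpha *m P] realises the slope. *)
pose P := invmx (diag_mx l) *m B.
have uP : P \in unitmx by rewrite unitmx_mul unitmx_inv ul uB.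
have slopeE : slope (col_mx P (- alpha *m P)) = alpha.
  by rewrite /slope col_mxKu col_mxKd mulmxK // opprK.
have costE : slope_cost c (col_mx P (- alpha *m P)) = l.
  rewrite /slope_cost slopeE; apply/matrixP=> i j; rewrite (ord1 i) [LHS]mxE [X in _ + X]mxE.
  have -> : (rsubmx c *m alpha) 0 j = l 0 j.
    by rewrite mxE big_ord1 -/cl [alpha _ _]mxE mulrA divff ?mul1r ?gt_eqF.
  by rewrite [l 0 j]mxE; lra.
exists (col_mx P (- alpha *m P)); split; rewrite ?slopeE ?costE ?col_mxKu //.
  by move=> i; rewrite mxE mulr_gt0 // invr_gt0.
rewrite mulKVmx //; exists s; split=> //; rewrite detB mulr1.
by rewrite ltrXn2r ?(ltW s0) //; move: sk; rewrite addrC subrK // -lt0n.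
Qed.

End AdmissibleBases.

(** * Bounds for the gap in terms of the determinant *)

Section GapBounds.
Context {R : realType} {k : nat}.
Hypothesis k_gt0 : (0 < k)%N.

Lemma det_scaled_basis (P : 'M[int]_k) (l : 'rV[rat]_k) :
  \det P != 0 -> (forall i, 0 < l 0 i) ->
  lattice_det (int_points R (int_lattice P)) * \prod_i ratr (l 0 i) =
    `|\det (diag_mx (map_mx ratr l : 'rV[R]_k) *m map_mx intr P)|.
Proof.
move=> detP l0; rewrite int_points_int_lattice lattice_det_basis; last first.
  by rewrite unitmxE unitfE det_map_mx intr_eq0.
rewrite det_mulmx normrM mulrC det_diag ger0_norm; last first.
  by apply: prodr_ge0 => i _; rewrite mxE ler0q ltW.
by congr (_ * _); apply: eq_bigr => i _; rewrite mxE.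
Qed.

Lemma gap_lower_bound (P : 'M[int]_k) (l : 'rV[rat]_k) :
  \det P != 0 -> (forall i, 0 < l 0 i) ->
  rho R k * (lattice_det (int_points R (int_lattice P)) *
               \prod_i ratr (l 0 i)) `^ (k%:R^-1) - \sum_i ratr (l 0 i)
  <= ratr (gap (int_lattice P) l).
Proof.
move=> detP l0; rewrite det_scaled_basis // lerBlDr.
have -> : \sum_i ratr (l 0 i) = \sum_i (map_mx ratr l : 'rV[R]_k) 0 i.
  by apply: eq_bigr => i _; rewrite mxE.
apply: rho_le_covers => //; last exact: covers_gap.
rewrite unitmxE unitfE det_mulmx mulf_neq0 //; last by rewrite det_map_mx intr_eq0.
by rewrite det_diag gt_eqF // prodr_gt0 // => i _; rewrite mxE ltr0q.
Qed.

Lemma gap_upper_bound (kappa : R) (P : 'M[int]_k) (l : 'rV[rat]_k) :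
  0 <= kappa -> \det P != 0 -> (forall i, 0 < l 0 i) ->
  efficient kappa (diag_mx (map_mx ratr l) *m map_mx intr P) ->
  ratr (gap (int_lattice P) l) <
    kappa * (lattice_det (int_points R (int_lattice P)) *
               \prod_i ratr (l 0 i)) `^ (k%:R^-1) - \sum_i ratr (l 0 i).
Proof.
move=> kap0 detP l0 [s [s0 cov ltB]]; rewrite det_scaled_basis //.
have := gap_le_covers P l detP l0 s cov.
have -> : \sum_i (map_mx ratr l : 'rV[R]_k) 0 i = \sum_i ratr (l 0 i).
  by apply: eq_bigr => i _; rewrite mxE.
move=> /le_lt_trans; apply; rewrite ltrD2r -(@ltr_pXn2r _ k) ?nnegrE ?(ltW s0) //.
  by rewrite exprMn powR_invnK.
by rewrite mulr_ge0 // powR_ge0.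
Qed.

End GapBounds.

(** * Positive rows on nonnegative vectors, and reduced costs *)

Section PositiveRow.
Context {T : numDomainType} {n : nat} (a : 'rV[T]_n).
Hypothesis a_gt0 : forall j, 0 < a 0 j.

Lemma positive_row_ge0 (x : 'cV[T]_n) : nonneg_vec x -> 0 <= (a *m x) 0 0.
Proof.
by move=> x0; rewrite mxE; apply: sumr_ge0 => j _; rewrite mulr_ge0 // ltW.
Qed.

Lemma positive_row_eq0 (x : 'cV[T]_n) :
  nonneg_vec x -> (a *m x) 0 0 <= 0 -> x = 0.
Proof.
move=> x0 le0; have /eqP : (a *m x) 0 0 = 0.
  by apply/eqP; rewrite eq_le le0 positive_row_ge0.
rewrite mxE psumr_eq0 => [/allP sum0|j _]; last by rewrite mulr_ge0 // ltW.
apply/matrixP=> j o; rewrite (ord1 o) [RHS]mxE; apply/eqP.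
have := implyP (sum0 j (mem_index_enum _)) isT.
by rewrite mulf_eq0 (gt_eqF (a_gt0 j)).
Qed.

End PositiveRow.

Lemma nonneg_col_mx (T : numDomainType) m n (x : 'cV[T]_m) (y : 'cV[T]_n) :
  nonneg_vec x -> nonneg_vec y -> nonneg_vec (col_mx x y).
Proof.
by move=> x0 y0 i; case: (split_ordP i) => j ->; rewrite ?col_mxEu ?col_mxEd.
Qed.

(** Eliminating the basic variable leaves a term depending on [A x] alone, so on a fibre of [A] only
    the nonbasic parts compete; this serves both the linear and the integer program. *)
Lemma cost_reducedE (F : fieldType) k (A : 'M[F]_(1, k + 1)) (c : 'rV[F]_(k + 1))
    (x : 'cV[F]_(k + 1)) :
  rsubmx A \in unitmx ->
  c *m x = rsubmx c *m invmx (rsubmx A) *m (A *m x) + reduced_cost A c *m usubmx x.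
Proof.
move=> uA; rewrite -{1}(hsubmxK c) -{1 2}(vsubmxK x) -{2}(hsubmxK A) !mul_row_col.
rewrite mulmxDr !mulmxA (mulmxKV uA) /reduced_cost mulmxBl [RHS]addrC.
by rewrite addrA subrK.
Qed.

Lemma invmx_11_gt0 (F : numFieldType) (M : 'M[F]_1) : 0 < M 0 0 -> 0 < invmx M 0 0.
Proof.
move=> M0; have uM : M \in unitmx by rewrite unitmxE unitfE det_mx11 gt_eqF.
have /matrixP/(_ 0 0) := mulmxV uM.
by rewrite !mxE big_ord1 eqxx => E; rewrite -(pmulr_rgt0 _ M0) E.
Qed.

(** * From a kernel basis to the row and its programs *)

Section Construction.
Context {R : realType} {k : nat}.
Hypothesis k_gt0 : (0 < k)%N.

Lemma Lambda_kernel (Q : 'M[int]_(k + 1, k)) (a : 'rV[int]_(k + 1)) :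
  a *m Q = 0 -> (forall x : 'cV[int]_(k + 1), a *m x = 0 -> exists z, x = Q *m z) ->
  Lambda a = int_lattice (usubmx Q).
Proof.
move=> aQ kera; apply/seteqP; split=> [_ [x /kera[z ->] <-]|_ [z _ <-]].
  by exists z; rewrite // mul_usub_mx.
by exists (Q *m z); [rewrite /int_kernel /= mulmxA aQ mul0mx | rewrite mul_usub_mx].
Qed.

(** In blocks [Q = [P; q]], the relation [a Q = 0] reads a_sigma P + a_{k+1} q = 0; multiplying by
    the inverse of [P] gives the slope. *)
Lemma kernel_row_slope (Q : 'M[int]_(k + 1, k)) (a : 'rV[int]_(k + 1)) :
  usubmx (map_mx intr Q : 'M[R]_(k + 1, k)) \in unitmx -> a *m Q = 0 ->
  lsubmx (map_mx intr a : 'rV[R]_(k + 1)) =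
    rsubmx (map_mx intr a) *m slope (map_mx intr Q).
Proof.
move=> uQ aQ; set aR := map_mx intr a; set QR := map_mx intr Q in uQ *.
have : aR *m QR = 0 by rewrite -map_mxM aQ map_mx0.
rewrite -{1}(hsubmxK aR) -{1}(vsubmxK QR) mul_row_col => /eqP.
rewrite addr_eq0 => /eqP /(congr1 (mulmx^~ (invmx (usubmx QR)))).
by rewrite /= mulmxK // => ->; rewrite /slope mulmxN mulNmx mulmxA.
Qed.

(** Since a_sigma is a_{k+1} times a positive slope, all entries share the sign of a_{k+1}; zero
    would give [a = 0], and a negative row is replaced by its opposite. *)
Lemma admissible_row (kappa : R) (c : 'rV[R]_(k + 1)) :
  rho R k < kappa -> (forall i, 0 < c 0 i) ->
  exists (Q : 'M[int]_(k + 1, k)) (a : 'rV[int]_(k + 1)),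
    [/\ admissible kappa c (map_mx intr Q), forall j, 0 < a 0 j, a *m Q = 0
      & forall x : 'cV[int]_(k + 1), a *m x = 0 -> exists z, x = Q *m z].
Proof.
move=> kap c0; have kap0 : 0 <= kappa by apply/ltW/(le_lt_trans _ kap)/rho_ge0.
have [X aX] := admissible_ex _ _ k_gt0 c0 kap.
have [Q [a [aQ a0 aQ0 kera]]] := admissible_primitive _ _ _ kap0 aX.
have [uQ sQ _ _] := aQ.
have entries (b : 'rV[int]_(k + 1)) : b *m Q = 0 -> forall i,
    (b 0 (lshift 1 i))%:~R = (b 0 (rshift k 0))%:~R * slope (map_mx intr Q) 0 i :> R.
  move=> bQ i; have /matrixP/(_ 0 i) := kernel_row_slope _ _ uQ bQ.
  by rewrite mxE mxE => ->; rewrite mxE big_ord1 mxE mxE.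
have pos (b : 'rV[int]_(k + 1)) : b *m Q = 0 -> 0 < b 0 (rshift k 0) ->
    forall j, 0 < b 0 j.
  move=> bQ b0 j; case: (split_ordP j) => i ->; last by rewrite (ord1 i).
  by rewrite -(ltr0z R) entries // mulr_gt0 ?ltr0z.
case: (ltgtP 0 (a 0 (rshift k 0))) => [a_gt|a_lt|a_eq].
- by exists Q, a; split=> //; apply: pos.
- have NaQ : - a *m Q = 0 by rewrite mulNmx aQ0 oppr0.
  exists Q, (- a); split=> //; first by apply: pos; rewrite // mxE oppr_gt0.
  by move=> x; rewrite mulNmx => /eqP; rewrite oppr_eq0 => /eqP /kera.
- case/eqP: a0; apply/matrixP=> i j; rewrite (ord1 i) [RHS]mxE.
  case: (split_ordP j) => i' ->; last by rewrite (ord1 i') -a_eq.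
  by apply: (@intr_inj R); rewrite entries // -a_eq mul0r.
Qed.

(** A feasible [y] costs more than the basic solution by a positive row applied to y_sigma >= 0;
    equality forces y_sigma = 0, and then [A y = b] fixes the last entry. *)
Lemma LP_optimal_basic (A : 'M[int]_(1, k + 1)) (c : 'rV[rat]_(k + 1)) (b : 'cV[int]_1) :
  (forall j, 0 < A 0 j) -> (forall i, 0 < reduced_cost (map_mx intr A) c 0 i) ->
  Sg A b ->
  exists2 x : 'cV[R]_(k + 1),
    LP_optimal R c A b = [set x] &
    basic_solution (map_mx intr A) (map_mx intr b) x.
Proof.
move=> A0 l0 [u u0 <-]; set bb := A *m u.
set AR : 'M[R]_(1, k + 1) := map_mx intr A.
set bR : 'cV[R]_1 := map_mx intr bb.
set cR : 'rV[R]_(k + 1) := map_mx ratr c.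
have At0 : 0 < rsubmx AR 0 0 by rewrite !mxE ltr0z.
have uA : rsubmx AR \in unitmx by rewrite unitmxE unitfE det_mx11 gt_eqF.
have lE : reduced_cost AR cR = map_mx ratr (reduced_cost (map_mx intr A) c).
  have AE : AR = map_mx ratr (map_mx intr A : 'M[rat]_(1, k + 1)).
    by apply/matrixP=> i j; rewrite !mxE ratr_int.
  by rewrite /reduced_cost map_mxB !map_mxM map_invmx !map_lsubmx !map_rsubmx -AE.
have lR0 i : 0 < reduced_cost AR cR 0 i by rewrite lE mxE ltr0q.
pose x : 'cV[R]_(k + 1) := col_mx 0 (invmx (rsubmx AR) *m bR).
have xf : LP_feasible R A bb x.
  split; first by rewrite -/AR -[AR in LHS]hsubmxK mul_row_col mulmx0 add0r mulKVmx.
  apply: nonneg_col_mx => [i|i]; first by rewrite mxE.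
  rewrite (ord1 i) mxE big_ord1 mulr_ge0 ?(ltW (invmx_11_gt0 _ _ At0)) //.
  by rewrite mxE ler0z positive_row_ge0.
have cost y : LP_feasible R A bb y ->
    (cR *m y) 0 0 = (cR *m x) 0 0 + (reduced_cost AR cR *m usubmx y) 0 0.
  move=> [yb _]; rewrite !(cost_reducedE _ _ AR cR) // yb; case: xf => -> _.
  by rewrite [usubmx x]col_mxKu mulmx0 addr0 mxE.
exists x; last by split; rewrite ?col_mxKu ?col_mxKd.
apply/seteqP; split=> [y [yf yopt]|_ ->]; last first.
  split=> // y yf; rewrite (cost y) // lerDl; case: yf => _ y0.
  by apply: positive_row_ge0 => // i; rewrite mxE.
have [yb y0] := yf.
have yu : usubmx y = 0.
  apply: (positive_row_eq0 _ lR0) => [i|]; first by rewrite mxE.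
  by have := yopt _ xf; rewrite (cost y) // gerDl.
rewrite /= -(vsubmxK y) yu /x; congr col_mx; rewrite -[bR]yb -/AR.
by rewrite -{2}(hsubmxK AR) -{2}(vsubmxK y) mul_row_col yu mulmx0 add0r mulKmx.
Qed.

(* If [x] attains the gap, then [b = A_sigma x] leaves the last coordinate
   free to vanish, so the omitted constraint [x_{k+1} >= 0] costs nothing. *)
Lemma IP_value_gap (A : 'M[int]_(1, k + 1)) (c : 'rV[rat]_(k + 1)) (P : 'M[int]_k) :
  \det P != 0 -> Lambda A = int_lattice P -> 0 < A 0 (rshift k 0) ->
  let l := reduced_cost (map_mx intr A) c in
  (forall i, 0 < l 0 i) ->
  exists2 b : 'cV[int]_1, Sg A b &
    IP_value c A b = gap (Lambda A) l +
      (rsubmx c *m invmx (rsubmx (map_mx intr A)) *m map_mx intr b) 0 0.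
Proof.
move=> detP LE At0 l l0; rewrite LE.
set AQ : 'M[rat]_(1, k + 1) := map_mx intr A in l l0 *.
have uA : rsubmx AQ \in unitmx.
  by rewrite unitmxE unitfE det_mx11 gt_eqF // !mxE ltr0z.
have [r -> _] := gapP P l detP.
have [x [Lx x0 -> minx]] := gap_minP P l detP l0 r.
pose X : 'cV[int]_(k + 1) := col_mx x 0.
have X0 : nonneg_vec X by apply: nonneg_col_mx => // i; rewrite mxE.
exists (A *m X); first by exists X.
have cost (y : 'cV[int]_(k + 1)) : A *m y = A *m X ->
    (c *m map_mx intr y) 0 0 = (l *m map_mx intr (usubmx y)) 0 0 +
      (rsubmx c *m invmx (rsubmx AQ) *m map_mx intr (A *m X)) 0 0.
  move=> Ay; rewrite (cost_reducedE _ _ AQ) // -map_mxM Ay mxE addrC.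
  by rewrite map_usubmx.
apply: min_ofE.
  by exists X => //; rewrite cost // [usubmx X]col_mxKu.
move=> _ [y [Ay y0] <-]; rewrite cost // lerD2r; apply: minx.
  (* Equal right-hand sides put [y - X] in the kernel, so [usubmx y] lies in the residue class of
     [r], over which [x] is minimal. *)
  have : Lambda A (usubmx (y - X)).
    by exists (y - X); rewrite // /int_kernel /= mulmxBr Ay subrr.
  rewrite LE linearB /= [usubmx X]col_mxKu => LyX.
  by rewrite -(subrKA x); apply: int_latticeD.
by move=> i; rewrite mxE.
Qed.

End Construction.

Theorem theorem1p2 (R : realType) (k : nat) (hk : (2 <= k)%N) :
  (forall (l : 'rV[rat]_k) (Lam : set 'cV[int]_k),
     (forall i, 0 < l 0 i) ->
     is_lattice (int_points R Lam) ->
     rho R k * (lattice_det (int_points R Lam) * \prod_i ratr (l 0 i))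
                 `^ (k%:R^-1)
       - \sum_i ratr (l 0 i)
     <= ratr (gap Lam l))
  /\
  (forall (c : 'rV[rat]_(k + 1)) (eps : R),
     (forall i, 0 < c 0 i) ->
     0 < eps ->
     exists A : 'M[int]_(1, k + 1),
       let AQ : 'M[rat]_(1, k + 1) := map_mx intr A in
       let l := reduced_cost AQ c in
       [/\ [/\ \rank AQ = 1%N,
               pointed (cone_of R A)
             & real_kernel R A `&` @nonneg_vec R (k + 1) = [set 0]],
           forall b : 'cV[int]_1, Sg A b ->
             exists2 x : 'cV[R]_(k + 1),
               LP_optimal R c A b = [set x]
               & basic_solution (map_mx intr A) (map_mx intr b) x,
           ratr (gap (Lambda A) l)
             < (rho R k + eps)
                 * (lattice_det (int_points R (Lambda A))
                      * \prod_i ratr (l 0 i)) `^ (k%:R^-1)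
               - \sum_i ratr (l 0 i)
         & exists2 b' : 'cV[int]_1,
             Sg A b'
             & IP_value c A b'
               = gap (Lambda A) l
                 + (rsubmx c *m invmx (rsubmx AQ) *m map_mx intr b') 0 0]).
Proof.
have k0 : (0 < k)%N by apply: leq_trans hk.
split=> [l Lam l0 /int_points_lattice[P detP ->]|c eps c0 eps0].
  exact: gap_lower_bound.
pose kappa := rho R k + eps.
have kap : rho R k < kappa by rewrite ltrDl.
have kap0 : 0 <= kappa by apply/ltW/(le_lt_trans _ kap)/rho_ge0.
have cR0 i : 0 < (map_mx ratr c : 'rV[R]_(k + 1)) 0 i by rewrite mxE ltr0q.
have [Q [A [aQ A0 AQ0 kerA]]] := admissible_row k0 _ _ kap cR0.
have [uQ _ cost0 effQ] := aQ.
have LE := Lambda_kernel _ _ AQ0 kerA.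
have detP : \det (usubmx Q) != 0.
  by move: uQ; rewrite -map_usubmx unitmxE unitfE det_map_mx intr_eq0.
exists A => AQ l.
have AE : map_mx ratr AQ = map_mx intr A :> 'M[R]_(1, k + 1).
  by apply/matrixP=> i j; rewrite !mxE ratr_int.
have uA : rsubmx (map_mx intr A : 'M[R]_(1, k + 1)) \in unitmx.
  by rewrite unitmxE unitfE det_mx11 gt_eqF // !mxE ltr0z.
(* The rational reduced cost of the constructed row is the vector for which [Q] was made admissible,
   so positivity and efficiency transfer to [l]. *)
have lE : map_mx ratr l = slope_cost (map_mx ratr c) (map_mx intr Q) :> 'rV[R]_k.
  rewrite /l /reduced_cost map_mxB !map_mxM map_invmx !map_lsubmx !map_rsubmx AE.
  by rewrite (kernel_row_slope _ _ uQ AQ0) mulmxA mulmxKV.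
have l0 i : 0 < l 0 i by have := cost0 i; rewrite -lE mxE ltr0q.
have AR0 j : 0 < (map_mx intr A : 'rV[R]_(k + 1)) 0 j by rewrite mxE ltr0z.
split.
- split.
  + rewrite rank_rV; apply/eqP; rewrite eqb1; apply: contraTneq (A0 (rshift k 0)).
    by move/matrixP/(_ 0 (rshift k 0)); rewrite !mxE => /eqP; rewrite intr_eq0 => /eqP ->.
  + apply/seteqP; split=> [x [[u u0 <-] [_ [v v0 <-] E]]|_ ->].
      apply/matrixP=> i j; rewrite (ord1 i) (ord1 j) [RHS]mxE; apply/eqP.
      rewrite eq_le positive_row_ge0 // andbT -E mxE oppr_le0.
      exact: positive_row_ge0.
    split; first by exists 0; rewrite ?mulmx0 // => i; rewrite mxE.
    exists 0; last by rewrite oppr0.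
    by exists 0; rewrite ?mulmx0 // => i; rewrite mxE.
  + apply/seteqP; split=> [x [Ax x0]|_ ->].
      by apply: (positive_row_eq0 _ AR0) => //; rewrite Ax mxE.
    by split=> [|i]; rewrite /real_kernel /= ?mulmx0 // mxE.
- move=> b; exact: LP_optimal_basic.
- rewrite LE; apply: gap_upper_bound => //.
  by rewrite lE map_usubmx.
- exact: IP_value_gap detP LE (A0 _) l0.
Qed.
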